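(* Let $f:[a,b]_{q,\omega}\times\mathbb{R}\times\mathbb{R}\to\mathbb{R}$ satisfy the standing assumptions listed in the context, let $\alpha,\beta\in\mathbb{R}$, and consider the problem of minimizing (maximizing) $$\mathcal{L}[y]=\int_a^b f(t,y(qt+\omega),D_{q,\omega}y(t))\,d_{q,\omega}t$$ over all $y\in\mathbb{E}$ with $y(a)=\alpha$, $y(b)=\beta$. Let $f(t,u,v)$ be jointly convex (concave) in $(u,v)$. If $\tilde y$ is an admissible function satisfying $$D_{q,\omega}\,\partial_3 f(t,\tilde y(qt+\omega),D_{q,\omega}\tilde y(t))=\partial_2 f(t,\tilde y(qt+\omega),D_{q,\omega}\tilde y(t))\quad\text{for all }t\in[a,b]_{q,\omega},$$ then $\tilde y$ is a global minimizer (maximizer) of the problem, i.e. $\mathcal{L}[\tilde y]\le\mathcal{L}[y]$ (respectively $\mathcal{L}[\tilde y]\ge\mathcal{L}[y]$) for every admissible $y$.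
   Context: Let $q\in(0,1)$ and $\omega>0$ be fixed, $\omega_0:=\frac{\omega}{1-q}$, and let $I\subseteq\mathbb{R}$ be a closed interval containing $\omega_0$; let $a,b\in I$ with $a<b$. For $k\in\mathbb{N}_0=\{0,1,2,\dots\}$ put $[k]_{q,\omega}:=\frac{\omega(1-q^k)}{1-q}$. Set $$[a,b]_{q,\omega}:=\{q^na+[n]_{q,\omega}:n\in\mathbb{N}_0\}\cup\{q^nb+[n]_{q,\omega}:n\in\mathbb{N}_0\}\cup\{\omega_0\},\qquad [s]_{q,\omega}:=\{q^ns+[n]_{q,\omega}:n\in\mathbb{N}_0\}\cup\{\omega_0\}\ (s\in I).$$ Hahn derivative: $D_{q,\omega}f(t):=\frac{f(qt+\omega)-f(t)}{(qt+\omega)-t}$ if $t\ne\omega_0$, and $D_{q,\omega}f(\omega_0):=f'(\omega_0)$, provided $f$ is differentiable at $\omega_0$. For functions on $[a,b]_{q,\omega}$ the same formula is used (the derivative at $\omega_0$ being taken along $[a,b]_{q,\omega}$). Jackson–Nörlund integral: $\int_{\omega_0}^{x}f(t)\,d_{q,\omega}t:=(x(1-q)-\omega)\sum_{k=0}^{\infty}q^kf(xq^k+[k]_{q,\omega})$ and $\int_a^b f\,d_{q,\omega}t:=\int_{\omega_0}^b f\,d_{q,\omega}t-\int_{\omega_0}^a f\,d_{q,\omega}t$, provided the series converge at $x=a$ and $x=b$. $\mathcal{D}$ is the set of all functions $[a,b]_{q,\omega}\to\mathbb{R}$ continuous at $\omega_0$. $\mathbb{E}$ is the linear space of $y\in\mathcal{D}$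 whose $q,\omega$-derivative is bounded on $[a,b]_{q,\omega}$ and continuous at $\omega_0$. A function $y\in\mathbb{E}$ is admissible if $y(a)=\alpha$, $y(b)=\beta$; $h\in\mathbb{E}$ is an admissible variation if $h(a)=h(b)=0$. $\partial_2f,\partial_3f$ are the partial derivatives of $f$ in its second and third arguments. $f(t,u,v)$ is jointly convex (concave) in $(u,v)$ iff $\partial_2f,\partial_3f$ exist and are continuous and $$f(t,u+u_1,v+v_1)-f(t,u,v)\ \ge(\le)\ \partial_2f(t,u,v)u_1+\partial_3f(t,u,v)v_1$$ for all $(t,u,v),(t,u+u_1,v+v_1)\in[a,b]_{q,\omega}\times\mathbb{R}^2$. A function $g(t,\cdot)$ is differentiable at $\theta_0$ uniformly in $t\in[s]_{q,\omega}$ if for every $\varepsilon>0$ there is $\delta>0$ such that $0<|\theta-\theta_0|<\delta$ implies $\left|\frac{g(t,\theta)-g(t,\theta_0)}{\theta-\theta_0}-\partial_2g(t,\theta_0)\right|<\varepsilon$ for all $t\in[s]_{q,\omega}$, where $\partial_2 g=\partial g/\partial\theta$. Standing assumptions on $f$: (1) $(u,v)\mapsto f(t,u,v)$ is $C^1(\mathbb{R}^2,\mathbb{R})$ for every $t\in[a,b]_{q,\omega}$; (2) for every admissible $y$, the functions $f(\cdot,y(\cdot),D_{q,\omega}y(\cdot))$, $\partial_2f(\cdot,y(\cdot),D_{q,\omega}y(\cdot))$, $\partial_3f(\cdot,y(\cdot),D_{q,\omega}y(\cdot))$ are continuous at $\omega_0$; (3) for every admissible $y$ and admissible variation $h$,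 the function $g(t,\varepsilon)=f(t,y(qt+\omega)+\varepsilon h(qt+\omega),D_{q,\omega}y(t)+\varepsilon D_{q,\omega}h(t))$, defined for $\varepsilon$ in some interval $]-\bar\varepsilon,\bar\varepsilon[$, is such that $g(t,\cdot)$ is differentiable at $0$ uniformly in $t\in[a]_{q,\omega}$ and uniformly in $t\in[b]_{q,\omega}$, the integrals $\int_{\omega_0}^a g(t,\varepsilon)\,d_{q,\omega}t$ and $\int_{\omega_0}^b g(t,\varepsilon)\,d_{q,\omega}t$ exist for $\varepsilon$ near $0$, and $\int_{\omega_0}^a\partial_2g(t,0)\,d_{q,\omega}t$ and $\int_{\omega_0}^b\partial_2g(t,0)\,d_{q,\omega}t$ exist.
   Formalization: Adds the hypothesis that a ≤ ω0 ≤ b, or a lies in [b]_{q,ω}, or b lies in [a]_{q,ω}; otherwise the integral from a to b is not monotone and the claim fails (e.g. q=ω=1/2, a=2, b=7/2, f=v², α=β=0, ỹ=0). *)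

(* Defs.v *)
From mathcomp Require Export all_boot all_order all_algebra.
From mathcomp Require Export all_classical all_reals all_analysis.

Set Implicit Arguments.
Unset Strict Implicit.
Unset Printing Implicit Defensive.

Export Order.TTheory GRing.Theory Num.Theory.
Export numFieldNormedType.Exports.

#[global] Open Scope classical_set_scope.
#[global] Open Scope ring_scope.

(* Functions on [a,b]_{q,w} are represented by total functions R -> R of which
   only the values on that set matter: every notion below that is attached to
   the lattice (limits, continuity, derivative at w0) is relative to it. *)

Definition hahn_fix (R : realType) (q w : R) : R := w / (1 - q).

Definition qw_num (R : realType) (q w : R) (k : nat) : R :=
  w * (1 - q ^+ k) / (1 - q).

(* [s]_{q,w} *)
Definition qw_orbit (R : realType) (q w s : R) : set R :=
  range (fun n : nat => q ^+ n * s + qw_num q w n) `|` [set hahn_fix q w].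

(* [a,b]_{q,w} *)
Definition qw_interval (R : realType) (q w a b : R) : set R :=
  range (fun n : nat => q ^+ n * a + qw_num q w n)
  `|` range (fun n : nat => q ^+ n * b + qw_num q w n)
  `|` [set hahn_fix q w].

Definition continuous_along (R : realType) (S : set R) (x0 : R) (y : R -> R) :=
  y x @[x --> within S (nbhs x0)] --> y x0.

Definition diffquot (R : realType) (y : R -> R) (x0 x : R) : R :=
  (y x - y x0) / (x - x0).

Definition derivable_along (R : realType) (S : set R) (x0 : R) (y : R -> R) :=
  cvg (diffquot y x0 x @[x --> within S x0^']).

Definition derive_along (R : realType) (S : set R) (x0 : R) (y : R -> R) : R :=
  lim (diffquot y x0 x @[x --> within S x0^']).

(* D_{q,w} y t for y on [a,b]_{q,w}; at t = w0 the value is meaningful only if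
   y is derivable along [a,b]_{q,w} there, which is required separately. *)
Definition hahn_derive (R : realType) (q w a b : R) (y : R -> R) (t : R) : R :=
  if t == hahn_fix q w
  then derive_along (qw_interval q w a b) (hahn_fix q w) y
  else (y (q * t + w) - y t) / ((q * t + w) - t).

Definition hahn_derivable (R : realType) (q w a b : R) (y : R -> R) :=
  derivable_along (qw_interval q w a b) (hahn_fix q w) y.

Definition jn_term (R : realType) (q w : R) (F : R -> R) (x : R) (k : nat) : R :=
  q ^+ k * F (x * q ^+ k + qw_num q w k).

(* existence of the integral of F from w0 to x *)
Definition jn_integrable (R : realType) (q w : R) (F : R -> R) (x : R) :=
  cvgn (series (jn_term q w F x)).

Definition jn_integral0 (R : realType) (q w : R) (F : R -> R) (x : R) : R :=
  (x * (1 - q) - w) * limn (series (jn_term q w F x)).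

Definition jn_integral (R : realType) (q w a b : R) (F : R -> R) : R :=
  jn_integral0 q w F b - jn_integral0 q w F a.

(* the space E *)
Definition hahn_space (R : realType) (q w a b : R) (y : R -> R) :=
  let S := qw_interval q w a b in
  let w0 := hahn_fix q w in
  [/\ continuous_along S w0 y,
      hahn_derivable q w a b y,
      exists M : R, forall t, S t -> `|hahn_derive q w a b y t| <= M &
      continuous_along S w0 (hahn_derive q w a b y)].

Definition admissible (R : realType) (q w a b alpha beta : R) (y : R -> R) :=
  [/\ hahn_space q w a b y, y a = alpha & y b = beta].

Definition admissible_variation (R : realType) (q w a b : R) (h : R -> R) :=
  [/\ hahn_space q w a b h, h a = 0 & h b = 0].

Definition partial2 (R : realType) (f : R -> R -> R -> R) (t u v : R) : R :=
  derive1 (fun x => f t x v) u.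

Definition partial3 (R : realType) (f : R -> R -> R -> R) (t u v : R) : R :=
  derive1 (f t u) v.

(* f t is C^1 on R^2 as a function of (u, v) *)
Definition C1_uv (R : realType) (f : R -> R -> R -> R) (t : R) :=
  [/\ forall u v, derivable (fun x => f t x v) u 1 /\ derivable (f t u) v 1,
      continuous (fun p : R * R => partial2 f t p.1 p.2) &
      continuous (fun p : R * R => partial3 f t p.1 p.2)].

Definition jointly_convex (R : realType) (S : set R) (f : R -> R -> R -> R) :=
  forall t, S t -> C1_uv f t /\
    forall u v u1 v1 : R,
      f t (u + u1) (v + v1) - f t u v
        >= partial2 f t u v * u1 + partial3 f t u v * v1.

Definition jointly_concave (R : realType) (S : set R) (f : R -> R -> R -> R) :=
  forall t, S t -> C1_uv f t /\
    forall u v u1 v1 : R,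
      f t (u + u1) (v + v1) - f t u v
        <= partial2 f t u v * u1 + partial3 f t u v * v1.

Definition uniformly_differentiable_at (R : realType) (S : set R)
    (g : R -> R -> R) (th0 : R) :=
  forall eps : R, 0 < eps -> exists2 delta : R, 0 < delta &
    forall th : R, 0 < `|th - th0| -> `|th - th0| < delta ->
    forall t, S t ->
      `|(g t th - g t th0) / (th - th0) - derive1 (g t) th0| < eps.

Definition variation_fun (R : realType) (q w a b : R) (f : R -> R -> R -> R)
    (y h : R -> R) (t eps : R) : R :=
  f t (y (q * t + w) + eps * h (q * t + w))
      (hahn_derive q w a b y t + eps * hahn_derive q w a b h t).

Definition standing_assumptions (R : realType) (q w a b alpha beta : R)
    (f : R -> R -> R -> R) :=
  let S := qw_interval q w a b in
  let w0 := hahn_fix q w in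
  let D := hahn_derive q w a b in
  [/\ forall t, S t -> C1_uv f t,
      forall y, admissible q w a b alpha beta y ->
        [/\ continuous_along S w0 (fun t => f t (y t) (D y t)),
            continuous_along S w0 (fun t => partial2 f t (y t) (D y t)) &
            continuous_along S w0 (fun t => partial3 f t (y t) (D y t))] &
      forall y h, admissible q w a b alpha beta y ->
        admissible_variation q w a b h ->
        let g := variation_fun q w a b f y h in
        forall s, s = a \/ s = b ->
        [/\ uniformly_differentiable_at (qw_orbit q w s) g 0,
            \forall eps \near 0, jn_integrable q w (fun t => g t eps) s &
            jn_integrable q w (fun t => derive1 (g t) 0) s]].

Definition hahn_functional (R : realType) (q w a b : R) (f : R -> R -> R -> R)
    (y : R -> R) : R :=
  jn_integral q w a b (fun t => f t (y (q * t + w)) (hahn_derive q w a b y t)).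

Definition euler_lagrange (R : realType) (q w a b : R) (f : R -> R -> R -> R)
    (y : R -> R) :=
  let D := hahn_derive q w a b in
  let P t := partial3 f t (y (q * t + w)) (D y t) in
  hahn_derivable q w a b P /\
  forall t, qw_interval q w a b t ->
    D P t = partial2 f t (y (q * t + w)) (D y t).

Definition global_minimizer (R : realType) (q w a b alpha beta : R)
    (f : R -> R -> R -> R) (y0 : R -> R) :=
  admissible q w a b alpha beta y0 /\
  forall y, admissible q w a b alpha beta y ->
    hahn_functional q w a b f y0 <= hahn_functional q w a b f y.

Definition global_maximizer (R : realType) (q w a b alpha beta : R)
    (f : R -> R -> R -> R) (y0 : R -> R) :=
  admissible q w a b alpha beta y0 /\
  forall y, admissible q w a b alpha beta y ->
    hahn_functional q w a b f y <= hahn_functional q w a b f y0.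

(* The integral from a to b is monotone in the integrand exactly in this case:
   if a and b lie strictly on the same side of w0 and neither is in the orbit
   of the other, the endpoint nearer to w0 contributes with negative weights
   (for f t u v = v ^+ 2 every extremal is then beaten by a variation that is
   nonzero at one lattice point only). *)
Definition jn_oriented (R : realType) (q w a b : R) :=
  [\/ a <= hahn_fix q w <= b, qw_orbit q w b a | qw_orbit q w a b].

(* Main.v *)
(** With h = y - y0 and P the partial derivative of f in v along y0, the
Euler-Lagrange equation and the Hahn product rule identify the first-order
part of f(y) - f(y0) with D(P h) at every lattice point other than w0. Its
Jackson-Norlund integral telescopes to P h at b minus P h at a, which is 0, and
convexity (concavity) compares the integrands. The integral is monotone because
[s_0 - w0 = q^-n (s_n - w0)] on an orbit: when one endpoint lies on the orbit of
the other, the two series differ by a finite sum with weights of one sign. The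
point w0 never matters, since it carries weight 0. *)
Require Import Defs.
From mathcomp Require Import ring lra.

Section Lattice.
Set Implicit Arguments.
Unset Strict Implicit.
Variables (R : realType) (q w : R).
Hypothesis hq : 0 < q < 1.
Implicit Types (F G p y z : R -> R) (a b s : R).
Local Notation w0 := (hahn_fix q w).
Local Notation orb s n := (q ^+ n * s + qw_num q w n).

(** * Orbits of [t -> q * t + w] and their convergence to [w0] *)

Lemma subr1_neq0 : 1 - q != 0.
Proof. by case/andP: hq => _ q1; rewrite subr_eq0 eq_sym lt_eqF. Qed.

(** The map [t -> q * t + w] is the homothety of ratio [q] centred at [w0]; signs and limits are
    read off from this form. *)
Lemma orbitE s n : orb s n = w0 + q ^+ n * (s - w0).
Proof. by rewrite /qw_num /hahn_fix; field; exact: subr1_neq0. Qed.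

Lemma orbit_neq s n : s != w0 -> orb s n != w0.
Proof.
move=> sw; rewrite orbitE -subr_eq0 addrC addKr mulf_neq0 ?subr_eq0//.
by rewrite expf_neq0// gt_eqF//; case/andP: hq.
Qed.

Lemma orbit_step s n : q * orb s n + w = orb s n.+1.
Proof. by rewrite /qw_num exprS; field; exact: subr1_neq0. Qed.

Lemma orbit_orbit s m n : orb (orb s m) n = orb s (m + n).
Proof. by rewrite 3!orbitE exprD; ring. Qed.

Lemma weightE s : s * (1 - q) - w = (1 - q) * (s - w0).
Proof. by rewrite /hahn_fix; field; exact: subr1_neq0. Qed.

Lemma orbit_cvg s : orb s n @[n --> \oo] --> w0.
Proof.
rewrite (_ : (fun n => _) = (fun n => w0 + q ^+ n * (s - w0))); last first.
  by apply/funext => n; rewrite orbitE.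
rewrite -[X in _ --> X]addr0 -(mul0r (s - w0)).
apply: cvgD; first exact: cvg_cst.
apply: cvgMr_tmp; apply: cvg_expr.
by case/andP: hq => q0 q1; rewrite gtr0_norm.
Qed.

Lemma orbit_cvg_within (S : set R) s : (forall n, S (orb s n)) ->
  orb s n @[n --> \oo] --> within S (nbhs w0).
Proof.
move=> Ss A /= wA; rewrite nbhs_simpl /=.
have := @orbit_cvg s _ wA; rewrite /nbhs /=.
by apply: filterS => n /=; apply; exact: Ss.
Qed.

Lemma orbit_cvg_within_dnbhs (S : set R) s : s != w0 ->
  (forall n, S (orb s n)) -> orb s n @[n --> \oo] --> within S w0^'.
Proof.
move=> sw Ss A /= wA; rewrite nbhs_simpl /=.
have := @orbit_cvg s _ wA; rewrite /nbhs /=.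
by apply: filterS => n /=; apply; [exact: orbit_neq|exact: Ss].
Qed.

(** The orbit of [s] stays in [S], avoids [w0] and tends to it, so an improper filter here would
    pull back to an improper filter on the indices. *)
Lemma within_dnbhs_proper (S : set R) s : s != w0 ->
  (forall n, S (orb s n)) -> ProperFilter (within S w0^').
Proof.
move=> sw Ss; split; last exact: within_filter.
move=> S0; have := orbit_cvg_within_dnbhs sw Ss S0.
exact: filter_not_empty.
Qed.

(** * Limits of functions along an orbit *)

Lemma continuous_along_orbit (S : set R) (p : R -> R) s :
  (forall n, S (orb s n)) -> continuous_along S w0 p ->
  p (orb s n) @[n --> \oo] --> p w0.
Proof. by move=> Ss cp; exact: cvg_comp (orbit_cvg_within Ss) cp. Qed.

(** The increment of [p] is a convergent difference quotient times [orb s n - w0], which tends to 0.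
    This serves for [partial3] along the extremal, which the Euler-Lagrange equation makes derivable
    at [w0]. *)
Lemma derivable_along_orbit (S : set R) (p : R -> R) s :
  (forall n, S (orb s n)) -> derivable_along S w0 p ->
  p (orb s n) @[n --> \oo] --> p w0.
Proof.
move=> Ss dp; have [sw|sw] := eqVneq s w0.
  (* From [w0] the orbit is constant and never enters a punctured neighbourhood. *)
  rewrite (_ : (fun n => _) = cst (p w0)); first exact: cvg_cst.
  by apply/funext => n; rewrite orbitE sw subrr mulr0 addr0.
have cd := cvg_comp _ _ (orbit_cvg_within_dnbhs sw Ss) dp.
rewrite (_ : (fun n => _) = (fun n => p w0 +
    diffquot p w0 (orb s n) * (orb s n - w0))); last first.
  apply/funext => n; rewrite /diffquot divfK ?subr_eq0 ?orbit_neq//.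
  by rewrite [RHS]addrC subrK.
rewrite -[X in _ --> X]addr0; apply: cvgD; first exact: cvg_cst.
rewrite -[X in _ --> X](mulr0 (lim (diffquot p w0 x @[x --> within S w0^']))).
apply: cvgM; first exact: cd.
rewrite -(subrr w0); apply: cvgB; [exact: orbit_cvg|exact: cvg_cst].
Qed.

(** * Jackson-Norlund integrals: linearity, change of base point, telescoping *)

Lemma jn_termE F s k : jn_term q w F s k = q ^+ k * F (orb s k).
Proof. by rewrite /jn_term (mulrC s). Qed.

Lemma series_jn_termD F G s : series (jn_term q w (F \+ G) s) =
  series (jn_term q w F s) \+ series (jn_term q w G s).
Proof.
apply/funext => n; rewrite /series /= -big_split /=.
by apply: eq_bigr => k _; rewrite /jn_term mulrDr.
Qed.

Lemma series_jn_termN F s :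
  series (jn_term q w (\- F) s) = \- series (jn_term q w F s).
Proof.
apply/funext => n; rewrite /series /= -sumrN.
by apply: eq_bigr => k _; rewrite /jn_term mulrN.
Qed.

Lemma jn_integrableD F G s : jn_integrable q w F s -> jn_integrable q w G s ->
  jn_integrable q w (F \+ G) s.
Proof.
by move=> cF cG; rewrite /jn_integrable series_jn_termD; exact: is_cvgD.
Qed.

Lemma jn_integral0D F G s : jn_integrable q w F s -> jn_integrable q w G s ->
  jn_integral0 q w (F \+ G) s = jn_integral0 q w F s + jn_integral0 q w G s.
Proof.
by move=> cF cG; rewrite /jn_integral0 -mulrDr series_jn_termD limD.
Qed.

Lemma jn_integrableN F s : jn_integrable q w F s ->
  jn_integrable q w (\- F) s.
Proof.
by move=> cF; rewrite /jn_integrable series_jn_termN; exact: is_cvgN.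
Qed.

Lemma jn_integral0N F s : jn_integrable q w F s ->
  jn_integral0 q w (\- F) s = - jn_integral0 q w F s.
Proof.
by move=> cF; rewrite /jn_integral0 -mulrN series_jn_termN limN.
Qed.

(** Starting at [orb s n] leaves the tail of the series divided by [q ^+ n], while the prefactor is
    multiplied by [q ^+ n]; the two factors cancel. *)
Lemma jn_integral0_orbit F s n : jn_integrable q w F s ->
  jn_integral0 q w F (orb s n) =
  jn_integral0 q w F s - (s * (1 - q) - w) * series (jn_term q w F s) n.
Proof.
move=> cF; rewrite /jn_integral0 -mulrBr.
have -> : orb s n * (1 - q) - w = (s * (1 - q) - w) * q ^+ n.
  by rewrite !weightE orbitE; ring.
rewrite -mulrA; congr (_ * _).
have qn0 : q ^+ n != 0 by rewrite expf_neq0// gt_eqF//; case/andP: hq.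
have sE m : series (jn_term q w F (orb s n)) m = (q ^+ n)^-1 *
    (series (jn_term q w F s) (m + n)%N - series (jn_term q w F s) n).
  apply: (mulfI qn0); rewrite mulVKf// /series /=.
  rewrite (@big_cat_nat _ _ _ n 0 (m + n)%N) ?leq_addl//= addrAC subrr add0r.
  rewrite -[in RHS](add0n n) big_addn addnK mulr_sumr.
  apply: eq_bigr => k _.
  by rewrite !jn_termE orbit_orbit (addnC k) exprD mulrA.
have cL : series (jn_term q w F (orb s n)) m @[m --> \oo] --> (q ^+ n)^-1 *
    (limn (series (jn_term q w F s)) - series (jn_term q w F s) n).
  rewrite (_ : series _ = fun m => (q ^+ n)^-1 *
    (series (jn_term q w F s) (m + n)%N - series (jn_term q w F s) n)).
    apply: cvgMl_tmp; apply: cvgB; last exact: cvg_cst.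
    by rewrite (cvg_shiftn n (series (jn_term q w F s))).
  exact/funext.
by rewrite (cvg_lim _ cL)// mulVKf.
Qed.

Lemma jn_integral0_hahn_derive a b p s :
  p (orb s n) @[n --> \oo] --> p w0 ->
  jn_integrable q w (hahn_derive q w a b p) s /\
  jn_integral0 q w (hahn_derive q w a b p) s = p s - p w0.
Proof.
set F := hahn_derive q w a b p => cp; have [sw|sw] := eqVneq s w0.
  (* The series is geometric, so it converges whatever [F w0] is, and the zero prefactor kills its
     sum. *)
  have FE k : jn_term q w F s k = F w0 * q ^+ k.
    by rewrite jn_termE orbitE sw subrr mulr0 addr0 mulrC.
  split; last by rewrite /jn_integral0 weightE sw !subrr mulr0 mul0r.
  rewrite /jn_integrable (_ : jn_term q w F s = geometric (F w0) q).
    apply: is_cvg_geometric_series.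
    by case/andP: hq => q0 q1; rewrite gtr0_norm.
  by apply/funext => k; rewrite FE.
have c0 : s * (1 - q) - w != 0.
  by rewrite weightE mulf_neq0 ?subr1_neq0// subr_eq0.
have FE k : jn_term q w F s k =
    (s * (1 - q) - w)^-1 * (p (orb s k) - p (orb s k.+1)).
  rewrite jn_termE /F /hahn_derive (negbTE (orbit_neq _ sw)) orbit_step.
  (* The gap between consecutive points is [- q ^+ k] times the prefactor, so the weight cancels the
     denominator of the Hahn derivative. *)
  have -> : orb s k.+1 - orb s k = - (q ^+ k * (s * (1 - q) - w)).
    by rewrite weightE 2!orbitE exprS; ring.
  have qk : q ^+ k != 0 by rewrite expf_neq0// gt_eqF//; case/andP: hq.
  by field; rewrite c0 qk.
have SE n : series (jn_term q w F s) n =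
    (s * (1 - q) - w)^-1 * (p s - p (orb s n)).
  rewrite /series /= (@telescope_sumr_eq _ _ _
    (fun k => - ((s * (1 - q) - w)^-1 * p (orb s k))))//.
    by rewrite (orbitE s 0) expr0 mul1r addrC (addrC w0) subrK; ring.
  by move=> k _; rewrite FE; ring.
have cS : series (jn_term q w F s) n @[n --> \oo] -->
    (s * (1 - q) - w)^-1 * (p s - p w0).
  rewrite (_ : series _ = fun n => (s * (1 - q) - w)^-1 * (p s - p (orb s n))).
    by apply: cvgMl_tmp; apply: cvgB => //; exact: cvg_cst.
  exact/funext.
split; first by apply/cvg_ex; eexists; exact: cS.
by rewrite /jn_integral0 (cvg_lim _ cS)// mulVKf.
Qed.

Lemma jn_integral_hahn_derive a b p :
  p (orb a n) @[n --> \oo] --> p w0 -> p (orb b n) @[n --> \oo] --> p w0 ->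
  jn_integral q w a b (hahn_derive q w a b p) = p b - p a.
Proof.
move=> /(jn_integral0_hahn_derive a b)[_ ia].
move=> /(jn_integral0_hahn_derive a b)[_ ib].
by rewrite /jn_integral ia ib; ring.
Qed.

(** * Positivity and monotonicity of the integral *)

Lemma series_jn_term_ge0 F s : s != w0 -> (forall n, 0 <= F (orb s n)) ->
  forall n, 0 <= series (jn_term q w F s) n.
Proof.
move=> sw F0 n; rewrite /series /=; apply: sumr_ge0 => k _.
by rewrite jn_termE mulr_ge0// exprn_ge0//; case/andP: hq => /ltW.
Qed.

Lemma jn_integral0_ge0 F s : w0 <= s -> jn_integrable q w F s ->
  (forall n, s != w0 -> 0 <= F (orb s n)) -> 0 <= jn_integral0 q w F s.
Proof.
move=> ws cF F0; rewrite /jn_integral0 weightE.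
have [->|sw] := eqVneq s w0; first by rewrite subrr mulr0 mul0r.
rewrite mulr_ge0//.
  by rewrite mulr_ge0 ?subr_ge0//; case/andP: hq => _ /ltW.
apply: limr_ge => //; apply: nearW => n.
by apply: series_jn_term_ge0 => // k; exact: F0.
Qed.

Lemma jn_integral0_le0 F s : s <= w0 -> jn_integrable q w F s ->
  (forall n, s != w0 -> 0 <= F (orb s n)) -> jn_integral0 q w F s <= 0.
Proof.
move=> ws cF F0; rewrite /jn_integral0 weightE.
have [->|sw] := eqVneq s w0; first by rewrite subrr mulr0 mul0r.
rewrite mulr_le0_ge0//.
  by rewrite mulr_ge0_le0 ?subr_ge0 ?subr_le0//; case/andP: hq => _ /ltW.
apply: limr_ge => //; apply: nearW => n.
by apply: series_jn_term_ge0 => // k; exact: F0.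
Qed.

Lemma qw_interval_orbitl a b n : qw_interval q w a b (orb a n).
Proof. by left; left; exists n. Qed.

Lemma qw_interval_orbitr a b n : qw_interval q w a b (orb b n).
Proof. by left; right; exists n. Qed.

(** If [w0] separates the endpoints, each half has the right sign. Otherwise the integral is a
    partial sum of the series at the endpoint farther from [w0], times a prefactor of known sign. *)
Lemma jn_integral_ge0 a b F : a < b -> jn_oriented q w a b ->
  jn_integrable q w F a -> jn_integrable q w F b ->
  (forall t, qw_interval q w a b t -> t != w0 -> 0 <= F t) ->
  0 <= jn_integral q w a b F.
Proof.
move=> ab hor ia ib F0; rewrite /jn_integral subr_ge0.
have Fa n : a != w0 -> 0 <= F (orb a n).
  by move=> aw; apply: F0; [exact: qw_interval_orbitl|exact: orbit_neq].
have Fb n : b != w0 -> 0 <= F (orb b n).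
  by move=> bw; apply: F0; [exact: qw_interval_orbitr|exact: orbit_neq].
have straddle : a <= w0 <= b -> jn_integral0 q w F a <= jn_integral0 q w F b.
  case/andP => aw wb; apply: (@le_trans _ _ 0).
    exact: jn_integral0_le0.
  exact: jn_integral0_ge0.
have [q0 q1] := andP hq.
have q10 : 0 < 1 - q by rewrite subr_gt0.
case: hor => [//|[[n _ an]|aw]|[[n _ bn]|bw]].
(* Since [a - w0 = q ^+ n * (b - w0)] with [q ^+ n <= 1], having [b <= w0] would give [b <= a]. *)
- have wb : w0 < b.
    rewrite -an orbitE in ab; have : q ^+ n <= 1 by rewrite exprn_ile1// ltW.
    by nra.
  rewrite -an jn_integral0_orbit// gerBl mulr_ge0//.
    by rewrite weightE mulr_ge0 ?subr_ge0// ltW.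
  by apply: series_jn_term_ge0 => [|k]; [|apply: Fb]; rewrite gt_eqF.
- by apply: straddle; rewrite aw lexx -aw ltW.
- have aw : a < w0.
    rewrite -bn orbitE in ab; have : q ^+ n <= 1 by rewrite exprn_ile1// ltW.
    by nra.
  rewrite -bn jn_integral0_orbit// lerBrDr gerDl mulr_le0_ge0//.
    by rewrite weightE mulr_ge0_le0 ?subr_le0// ltW.
  by apply: series_jn_term_ge0 => [|k]; [|apply: Fa]; rewrite lt_eqF.
- by apply: straddle; rewrite bw lexx -bw ltW.
Qed.

Lemma jn_integralD a b F G :
  jn_integrable q w F a -> jn_integrable q w F b ->
  jn_integrable q w G a -> jn_integrable q w G b ->
  jn_integral q w a b (F \+ G) = jn_integral q w a b F + jn_integral q w a b G.
Proof.
by move=> Fa Fb Ga Gb; rewrite /jn_integral !jn_integral0D//; ring.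
Qed.

Lemma jn_integralN a b F :
  jn_integrable q w F a -> jn_integrable q w F b ->
  jn_integral q w a b (\- F) = - jn_integral q w a b F.
Proof. by move=> Fa Fb; rewrite /jn_integral !jn_integral0N//; ring. Qed.

Lemma le_jn_integral a b F G : a < b -> jn_oriented q w a b ->
  jn_integrable q w F a -> jn_integrable q w F b ->
  jn_integrable q w G a -> jn_integrable q w G b ->
  (forall t, qw_interval q w a b t -> t != w0 -> F t <= G t) ->
  jn_integral q w a b F <= jn_integral q w a b G.
Proof.
move=> ab hor Fa Fb Ga Gb FG.
have Na := jn_integrableN Fa; have Nb := jn_integrableN Fb.
rewrite -subr_ge0 -jn_integralN// -jn_integralD//.
apply: jn_integral_ge0 => //; [exact: jn_integrableD|exact: jn_integrableD|].
by move=> t St tw /=; rewrite subr_ge0 FG.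
Qed.

(** * Integrability of the integrand, through the zero variation *)

Lemma derive_along_cst a b c : a != b ->
  derivable_along (qw_interval q w a b) w0 (fun=> c) /\
  hahn_derive q w a b (fun=> c) = fun=> 0.
Proof.
move=> ab; set S := qw_interval q w a b.
(* Computing [lim] needs a proper filter: of two distinct endpoints one differs from [w0], and its
   orbit accumulates there. *)
have PF : ProperFilter (within S w0^').
  have [aw|aw] := eqVneq a w0; last first.
    by apply: within_dnbhs_proper aw _ => n; exact: qw_interval_orbitl.
  apply: (@within_dnbhs_proper _ b); first by rewrite -aw eq_sym.
  by move=> n; exact: qw_interval_orbitr.
have dE : diffquot (fun=> c) w0 = fun=> 0.
  by apply/funext => x; rewrite /diffquot subrr mul0r.
have c0 : diffquot (fun=> c) w0 x @[x --> within S w0^'] --> (0 : R).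
  by rewrite dE; exact: cvg_cst.
split; first by apply/cvg_ex; exists 0.
apply/funext => t; rewrite /hahn_derive /derive_along (cvg_lim _ c0)//.
by rewrite subrr mul0r if_same.
Qed.

Lemma admissible_variation0 a b : a != b ->
  admissible_variation q w a b (fun=> 0).
Proof.
move=> ab; have [d0 D0] := derive_along_cst 0 ab.
split=> //; split=> //; rewrite ?D0; try exact: cvg_cst.
by exists 0 => t _; rewrite normr0.
Qed.

(** The standing assumptions give integrability for [eps] near 0; at [eps = 0] with the zero
    variation this concerns the integrand itself. *)
Lemma integrand_integrable a b alpha beta f y s : a != b ->
  standing_assumptions q w a b alpha beta f ->
  admissible q w a b alpha beta y -> s = a \/ s = b ->
  jn_integrable q w (fun t => f t (y (q * t + w)) (hahn_derive q w a b y t)) s.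
Proof.
move=> ab [_ _ hf] hy hs.
have [_ /nbhs_singleton] := hf _ _ hy (admissible_variation0 ab) _ hs.
rewrite (_ : variation_fun _ _ _ _ _ _ _ ^~ 0 =
  fun t => f t (y (q * t + w)) (hahn_derive q w a b y t))//.
by apply/funext => t; rewrite /variation_fun !mul0r !addr0.
Qed.

(** * Hahn product rule and the first-order part of the increment *)

Lemma hahn_deriveM a b y z t : t != w0 ->
  hahn_derive q w a b (y \* z) t =
  hahn_derive q w a b y t * z (q * t + w) + y t * hahn_derive q w a b z t.
Proof.
move=> tw; rewrite /hahn_derive (negbTE tw) /=; field.
rewrite (_ : q * t + w - t = - (t * (1 - q) - w)); last by ring.
by rewrite oppr_eq0 weightE mulf_neq0 ?subr1_neq0// subr_eq0.
Qed.

Lemma hahn_deriveB a b y z t : t != w0 ->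
  hahn_derive q w a b (y \- z) t =
  hahn_derive q w a b y t - hahn_derive q w a b z t.
Proof.
move=> tw; rewrite /hahn_derive (negbTE tw) /= -mulrBl.
by congr (_ / _); ring.
Qed.

(* The derivative of [p] is the first-order part of the increment of the
   integrand from [y0] to [y]. *)
Lemma euler_lagrange_null a b alpha beta f y0 y :
  let P t := partial3 f t (y0 (q * t + w)) (hahn_derive q w a b y0 t) in
  let p := P \* (y \- y0) in
  admissible q w a b alpha beta y0 -> admissible q w a b alpha beta y ->
  euler_lagrange q w a b f y0 ->
  [/\ jn_integrable q w (hahn_derive q w a b p) a,
      jn_integrable q w (hahn_derive q w a b p) b,
      jn_integral q w a b (hahn_derive q w a b p) = 0 &
      forall t, qw_interval q w a b t -> t != w0 ->
        hahn_derive q w a b p t =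
        partial2 f t (y0 (q * t + w)) (hahn_derive q w a b y0 t) *
          (y (q * t + w) - y0 (q * t + w)) +
        P t * (hahn_derive q w a b y t - hahn_derive q w a b y0 t)].
Proof.
move=> P p [[cy0 _ _ _] y0a y0b] [[cy _ _ _] ya yb] [dP EL].
(* Continuity of [P] comes from its derivability at [w0], that of [y] and [y0] from membership in
   the space E. *)
have cp s : (forall n, qw_interval q w a b (orb s n)) ->
    p (orb s n) @[n --> \oo] --> p w0.
  move=> Ss; apply: cvgM; first exact: (derivable_along_orbit Ss dP).
  apply: cvgB; first exact: (continuous_along_orbit Ss cy).
  exact: (continuous_along_orbit Ss cy0).
have cpa := cp a (qw_interval_orbitl a b).
have cpb := cp b (qw_interval_orbitr a b).
split.
- by case: (jn_integral0_hahn_derive a b cpa).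
- by case: (jn_integral0_hahn_derive a b cpb).
(* Both boundary terms vanish because [y] and [y0] agree at [a] and at [b]. *)
- rewrite jn_integral_hahn_derive// /p /= ya yb y0a y0b.
  by rewrite !subrr !mulr0 subrr.
(* The product rule evaluates the second factor at [q * t + w], exactly where the integrand
   evaluates [y]. *)
- by move=> t St tw; rewrite hahn_deriveM// EL// hahn_deriveB.
Qed.

End Lattice.

Theorem theorem3p5 (R : realType) (q w : R) (hq : 0 < q < 1) (hw : 0 < w)
    (I : set R) (hI : is_interval I) (hIc : closed I) (hI0 : I (hahn_fix q w))
    (a b : R) (ha : I a) (hb : I b) (hab : a < b)
    (hor : jn_oriented q w a b)
    (alpha beta : R) (f : R -> R -> R -> R)
    (hf : standing_assumptions q w a b alpha beta f)
    (y0 : R -> R) (hy0 : admissible q w a b alpha beta y0)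
    (hEL : euler_lagrange q w a b f y0) :
  (jointly_convex (qw_interval q w a b) f ->
     global_minimizer q w a b alpha beta f y0) /\
  (jointly_concave (qw_interval q w a b) f ->
     global_maximizer q w a b alpha beta f y0).
Proof.
have ab : a != b by rewrite lt_eqF.
have int y s (hy : admissible q w a b alpha beta y) :=
  integrand_integrable hq ab hf hy (s := s).
have hE y (hy : admissible q w a b alpha beta y) :=
  euler_lagrange_null hq hy0 hy hEL.
have inc (u v : R) : u + (v - u) = v by rewrite addrC subrK.
split=> hc; split=> // y hy; have [pa pb p0 pE] := hE y hy;
  have [Fa Fb] := (int y a hy (or_introl erefl), int y b hy (or_intror erefl));
  have [Ga Gb] :=
    (int y0 a hy0 (or_introl erefl), int y0 b hy0 (or_intror erefl));
  rewrite /hahn_functional.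
(* Adding the null integral to the value at [y0] reduces the claim to a comparison of integrands off
   [w0], which is the convexity inequality with the increments from [y0] to [y]. *)
- rewrite -[leLHS]addr0 -{1}p0 -jn_integralD//.
  apply: le_jn_integral => //; [exact: jn_integrableD|exact: jn_integrableD|].
  move=> t St tw /=; rewrite pE// -lerBrDl.
  have := (hc t St).2 (y0 (q * t + w)) (hahn_derive q w a b y0 t)
    (y (q * t + w) - y0 (q * t + w))
    (hahn_derive q w a b y t - hahn_derive q w a b y0 t).
  by rewrite !inc.
(* For concavity the null integral is added on the right, where the value at [y0] now stands. *)
- rewrite -[leRHS]addr0 -{1}p0 -jn_integralD//.
  apply: le_jn_integral => //; [exact: jn_integrableD|exact: jn_integrableD|].
  move=> t St tw /=; rewrite pE// -lerBlDl.
  have := (hc t St).2 (y0 (q * t + w)) (hahn_derive q w a b y0 t)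
    (y (q * t + w) - y0 (q * t + w))
    (hahn_derive q w a b y t - hahn_derive q w a b y0 t).
  by rewrite !inc.
Qed.
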